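(* Let $\tilde P_1,\tilde P_2$ be random probability measures on $\mathbb{X}$, defined on the same probability space, such that for $i=1,2$, $\tilde P_i$ is almost surely discrete and $\mathbb{E}[\tilde P_i]$ is atomless. Let $f$ be a probability density kernel on $\mathbb{Y}\times\mathbb{X}$ and $k$ a kernel on $\mathbb{Y}$, and let $k_f(x_1,x_2)=\iint_{\mathbb{Y}\times\mathbb{Y}}k(y_1,y_2)f(y_1;x_1)f(y_2;x_2)\,dy_1\,dy_2$. If $k_f$ is $c_0$-universal on $\mathbb{X}$, then $\mathrm{Corr}_k(f_{\tilde P_1},f_{\tilde P_2})=1$ if and only if $f_{\tilde P_1}=f_{\tilde P_2}$ almost surely.
   Context: $\mathbb{X}$ (latent space) and $\mathbb{Y}$ (observation space) are locally compact Polish spaces with their Borel $\sigma$-algebras; $\mathbb{Y}$ carries a reference $\sigma$-finite measure denoted $dy$. A probability density kernel $f$ on $\mathbb{Y}\times\mathbb{X}$ is a jointly measurable function $(y,x)\mapsto f(y;x)\ge0$ with $\int_{\mathbb{Y}}f(y;x)\,dy=1$ for every $x\in\mathbb{X}$. For a probability measure $P$ on $\mathbb{X}$ the mixture density is $f_P(y)=\int_{\mathbb{X}}f(y;x)\,dP(x)$, identified with the probability measure $f_P(y)\,dy$ on $\mathbb{Y}$ (so densities are equal if they agree $dy$-a.e.); thus $f_{\tilde P}$ is a random probability on $\mathbb{Y}$ when $\tilde P$ is one on $\mathbb{X}$. For a space $\mathbb{S}\in\{\mathbb{X},\mathbb{Y}\}$: $\mathcal{M}_b(\mathbb{S})$ is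 the space of finite signed measures and $\mathcal{P}(\mathbb{S})$ the set of probability measures on $\mathbb{S}$, with the $\sigma$-algebra generated by evaluations $\xi\mapsto\xi(A)$; a kernel on $\mathbb{S}$ is a measurable function $k:\mathbb{S}\times\mathbb{S}\to\mathbb{R}$ that is bounded, symmetric and positive-definite ($\sum_{i,j}a_ia_jk(s_i,s_j)\ge0$ for all finite families); $\mathbb{H}_k$ is its reproducing kernel Hilbert space; the kernel mean embedding of $\xi\in\mathcal{M}_b(\mathbb{S})$ is $\mu_k(\xi)\in\mathbb{H}_k$, $\mu_k(\xi)(t)=\int k(s,t)\,d\xi(s)$, with $\langle\mu_k(\xi_1),\mu_k(\xi_2)\rangle_{\mathbb{H}_k}=\iint k\,d\xi_1\,d\xi_2$. A kernel is $c_0$ if $\{s:|k(s,t)|\ge\varepsilon\}$ is compact for all $\varepsilon>0$, $t\in\mathbb{S}$; a $c_0$-kernel is $c_0$-universal if $\mu_k$ is injective on $\mathcal{M}_b(\mathbb{S})$ (equivalently, $\mathbb{H}_k$ is dense in $C_0(\mathbb{S})$ for the uniform norm). A random probability on $\mathbb{S}$ is a random element of $\mathcal{P}(\mathbb{S})$; its mean measure is $\mathbb{E}[\tilde Q](A)=\mathbb{E}[\tilde Q(A)]$. $\mathrm{Cov}_k(\tilde Q_1,\tilde Q_2)=\mathbb{E}\big[\langle\mu_k(\tilde Q_1)-\mathbb{E}[\mu_k(\tilde Q_1)],\mu_k(\tilde Q_2)-\mathbb{E}[\mu_k(\tilde Q_2)]\rangle_{\mathbb{H}_k}\big]$, where $\mathbb{E}[V]$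 is characterised by $\langle h,\mathbb{E}[V]\rangle=\mathbb{E}\langle h,V\rangle$ for all $h\in\mathbb{H}_k$; $\mathrm{Var}_k(\tilde Q)=\mathrm{Cov}_k(\tilde Q,\tilde Q)$; when both kernel variances are positive $\mathrm{Corr}_k(\tilde Q_1,\tilde Q_2)=\mathrm{Cov}_k(\tilde Q_1,\tilde Q_2)/\big(\sqrt{\mathrm{Var}_k(\tilde Q_1)}\sqrt{\mathrm{Var}_k(\tilde Q_2)}\big)$. *)

(* Defs.v *)
From HB Require Import structures.
From mathcomp Require Import all_boot all_order all_algebra.
From mathcomp Require Import all_classical all_reals all_analysis.
From mathcomp Require Import measurable_realfun.

Set Implicit Arguments.
Unset Strict Implicit.
Unset Printing Implicit Defensive.

Import Order.TTheory GRing.Theory Num.Theory.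
Import numFieldNormedType.Exports.

Local Open Scope classical_set_scope.
Local Open Scope ring_scope.

Section spaces.
Context (R : realType).

Definition compatible_metric (T : topologicalType) (d : T -> T -> R) : Prop :=
  [/\ forall x y, 0 <= d x y,
      forall x y, d x y = 0 <-> x = y,
      forall x y, d x y = d y x,
      forall x y z, d x z <= d x y + d y z &
      forall x (A : set T),
        nbhs x A <-> exists2 e, 0 < e & [set y | d x y < e] `<=` A].

Definition complete_metric (T : topologicalType) (d : T -> T -> R) : Prop :=
  forall u : nat -> T,
    (forall e, 0 < e ->
      exists N, forall m n, (N <= m)%N -> (N <= n)%N -> d (u m) (u n) < e) ->
    exists l : T, u @ \oo --> l.

Definition polish (T : topologicalType) : Prop :=
  (exists2 D : set T, countable D & dense D) /\
  (exists2 d : T -> T -> R, compatible_metric d & complete_metric d).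

(* T with its Borel sigma-algebra; the carrier is T itself. *)
Definition borel (T : ptopologicalType) : measurableType _ :=
  g_sigma_algebraType (@open T).

End spaces.

Section kernels.
Context (R : realType) d (S : measurableType d).

Definition is_kernel (k : S -> S -> R) : Prop :=
  [/\ measurable_fun [set: S * S] (fun z => k z.1 z.2),
      exists M, forall s t, `|k s t| <= M,
      forall s t, k s t = k t s &
      forall n (a : 'I_n -> R) (s : 'I_n -> S),
        0 <= \sum_(i < n) \sum_(j < n) a i * a j * k (s i) (s j)].

(* Integral against a finite signed measure: the difference of the integrals
   against its Jordan parts, which do not depend on the Hahn decomposition
   that is picked. *)
Definition charge_integral (nu : {charge set S -> \bar R}) (h : S -> R) : R :=
  let P := cid (Hahn_decomposition nu) in
  let nuPN := svalP (cid (svalP P)) in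
  \int[jordan_pos nuPN]_s h s - \int[jordan_neg nuPN]_s h s.

Definition mean_embedding (k : S -> S -> R) (nu : {charge set S -> \bar R}) :
  S -> R := fun t => charge_integral nu (k ^~ t).

End kernels.

Section universality.
Context (R : realType) (T : ptopologicalType).

Definition c0 (k : T -> T -> R) : Prop :=
  forall e t, 0 < e -> compact [set s | e <= `|k s t|].

(* Only applied to kernels; injectivity of the mean embedding on finite signed
   measures.  Those are compared on measurable sets only, as the value of a
   charge outside the sigma-algebra carries no meaning. *)
Definition c0_universal (k : borel T -> borel T -> R) : Prop :=
  @c0 k /\
  forall nu1 nu2 : {charge set (borel T) -> \bar R},
    mean_embedding k nu1 = mean_embedding k nu2 ->
    forall A : set (borel T), measurable A -> nu1 A = nu2 A.

End universality.

(* A reproducing kernel Hilbert space of k, as a space of functions on S.  By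
   the Moore-Aronszajn theorem it exists and is unique (same functions, same
   inner product) for every symmetric positive-definite k.  The form [rdot] is
   meaningful on [rmem] only. *)
Record rkhs (R : realType) (S : Type) (k : S -> S -> R) := RKHS {
  rmem : set (S -> R) ;
  rdot : (S -> R) -> (S -> R) -> R ;
  rmem0 : rmem 0 ;
  rmemD : forall a g h, rmem g -> rmem h -> rmem (a *: g + h) ;
  rdotC : forall g h, rmem g -> rmem h -> rdot g h = rdot h g ;
  rdotD : forall a g g' h, rmem g -> rmem g' -> rmem h ->
    rdot (a *: g + g') h = a * rdot g h + rdot g' h ;
  rdot_ge0 : forall g, rmem g -> 0 <= rdot g g ;
  rdot_eq0 : forall g, rmem g -> rdot g g = 0 -> g = 0 ;
  rcomplete : forall u : nat -> S -> R, (forall n, rmem (u n)) ->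
    (forall e, 0 < e -> exists N, forall m n, (N <= m)%N -> (N <= n)%N ->
      Num.sqrt (rdot (u m - u n) (u m - u n)) < e) ->
    exists2 l, rmem l &
      (fun n => Num.sqrt (rdot (u n - l) (u n - l))) @ \oo --> (0 : R) ;
  rmem_section : forall s, rmem (k s) ;
  rreproducing : forall g s, rmem g -> rdot g (k s) = g s
}.

Section random_measures.
Context (R : realType) dO (Omega : measurableType dO) (Pr : probability Omega R).

Definition mean_measure d (S : measurableType d)
    (Q : Omega -> probability S R) (A : set S) : \bar R :=
  (\int[Pr]_w Q w A)%E.

(* On a Polish space, having no atom amounts to charging no point. *)
Definition atomless (T : Type) (mu : set T -> \bar R) : Prop :=
  forall x, mu [set x] = 0%E.

(* Countable sets are Borel in a Polish space. *)
Definition discrete_measure (T : Type) (mu : set T -> \bar R) : Prop :=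
  exists2 A : set T, countable A & mu (~` A) = 0%E.

(* The unique m in H such that <h, m> = E<h, V> for every h in H. *)
Definition rkhs_expectation (S : Type) (k : S -> S -> R) (H : rkhs k)
    (V : Omega -> S -> R) : S -> R :=
  xget 0 [set m | rmem H m /\
    forall h, rmem H h -> (rdot H h m)%:E = ('E_Pr[fun w => rdot H h (V w)])%E].

Section moments.
Context d (S : measurableType d) (k : S -> S -> R) (H : rkhs k).
Implicit Types Q : Omega -> probability S R.

Definition random_embedding Q (w : Omega) : S -> R :=
  mean_embedding k (charge_of_finite_measure (Q w)).

Definition kcov Q1 Q2 : R :=
  let V1 := random_embedding Q1 in let V2 := random_embedding Q2 in
  let m1 := rkhs_expectation H V1 in let m2 := rkhs_expectation H V2 in
  fine ('E_Pr[fun w => rdot H (V1 w - m1)%R (V2 w - m2)%R])%E.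

Definition kvar Q : R := kcov Q Q.

(* Division by 0 yields 0, so kcorr Q1 Q2 = 1 forces both variances to be
   positive. *)
Definition kcorr Q1 Q2 : R :=
  kcov Q1 Q2 / (Num.sqrt (kvar Q1) * Num.sqrt (kvar Q2)).

End moments.
End random_measures.

Record density_kernel (R : realType) dX dY (X : measurableType dX)
    (Y : measurableType dY) (nu : {measure set Y -> \bar R}) := DensityKernel {
  dk_fun :> Y -> X -> R ;
  dk_measurable : measurable_fun [set: Y * X] (fun z => dk_fun z.1 z.2) ;
  dk_ge0 : forall y x, 0 <= dk_fun y x ;
  dk_int1 : forall x, (\int[nu]_y (dk_fun y x)%:E = 1)%E
}.

Section mixtures.
Context (R : realType) dX dY (X : measurableType dX) (Y : measurableType dY).
Variables (nu : {sigma_finite_measure set Y -> \bar R}).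
Variables (f : density_kernel X nu).

Definition smooth_kernel (k : Y -> Y -> R) (x1 x2 : X) : R :=
  \int[(nu \x nu)%E]_z (k z.1 z.2 * f z.1 x1 * f z.2 x2).

Variable P : probability X R.

(* Extended-real valued: it may be infinite on a nu-negligible set. *)
Definition mixture_density (y : Y) : \bar R := (\int[P]_x (f y x)%:E)%E.

Lemma mixture_density_ge0 y : (0 <= mixture_density y)%E.
Proof. by apply: integral_ge0 => x _; rewrite lee_fin dk_ge0. Qed.

Lemma measurable_mixture_density : measurable_fun [set: Y] mixture_density.
Proof.
apply: (@measurable_fun_fubini_tonelli_F _ _ Y X R P
  (fun z => (f z.1 z.2)%:E)).
- by apply/measurable_EFinP; exact: dk_measurable.
- by move=> z; rewrite lee_fin dk_ge0.
Qed.

Definition mixture (A : set Y) : \bar R := (\int[nu]_(y in A) mixture_density y)%E.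

Let mixture0 : mixture set0 = 0%E.
Proof. exact: integral_set0. Qed.

Let mixture_ge0 A : (0 <= mixture A)%E.
Proof. by apply: integral_ge0 => y _; exact: mixture_density_ge0. Qed.

Let mixture_sigma_additive : semi_sigma_additive mixture.
Proof.
move=> F mF tF mUF; rewrite /mixture ge0_integral_bigcup//; last 2 first.
- exact: measurable_funTS measurable_mixture_density.
- by move=> y _; exact: mixture_density_ge0.
apply: is_cvg_ereal_nneg_natsum_cond => n _ _.
exact: mixture_ge0.
Qed.

HB.instance Definition _ := isMeasure.Build _ _ _ mixture
  mixture0 mixture_ge0 mixture_sigma_additive.

Let mixture_setT : mixture [set: Y] = 1%E.
Proof.
have mf : measurable_fun [set: Y * X] (fun z => (f z.1 z.2)%:E).
  by apply/measurable_EFinP; exact: dk_measurable.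
rewrite /mixture /mixture_density.
rewrite (@fubini_tonelli _ _ _ _ _ nu P (fun z => (f z.1 z.2)%:E))//=; last first.
  by move=> z; rewrite lee_fin dk_ge0.
rewrite (eq_integral (fun=> 1%E)) => [|x _]; last exact: dk_int1.
by rewrite integral_cst// mul1e; exact: probability_setT.
Qed.

HB.instance Definition _ :=
  @Measure_isProbability.Build _ _ R mixture mixture_setT.

End mixtures.

(* Main.v *)
(** The mean embedding of a mixture [f_P] in the reproducing kernel Hilbert
    space of [k] is linear in [P], and integrating it against [f (.; t)] gives
    the embedding of [P] for the smoothed kernel [k_f]. Equality in the
    Cauchy-Schwarz inequality means that the centered embeddings satisfy
    [V1 - E V1 = a (V2 - E V2)] almost surely for some [a >= 0], hence the
    embeddings of the measures [P1 + a E P2] and [E P1 + a P2] agree, and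
    injectivity for [k_f] yields [P1 + a E P2 = E P1 + a P2]. Testing this on a
    countable set that carries the discrete measures and is not charged by the
    atomless ones gives [P1 = a P2], and total masses force [a = 1]. The same
    argument with [a = 0] shows that the variances do not vanish, which is what
    the converse needs. *)

Require Import Defs.
From HB Require Import structures.
From mathcomp Require Import all_boot all_order all_algebra.
From mathcomp Require Import all_classical all_reals all_analysis.
From mathcomp Require Import measurable_realfun giry.
From mathcomp Require Import ring lra.

Set Implicit Arguments.
Unset Strict Implicit.
Unset Printing Implicit Defensive.

Import Order.TTheory GRing.Theory Num.Theory.
Import numFieldNormedType.Exports.

Local Open Scope classical_set_scope.
Local Open Scope ring_scope.

(** * Hilbert space geometry of an RKHS and Riesz representation on closed subspaces *)

Section rkhs_theory.
Context (R : realType) (S : Type) (k : S -> S -> R) (H : rkhs k).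
Implicit Types (g h : S -> R) (a : R).
Local Notation mem := (rmem H).
Local Notation "''[' g , h ]" := (rdot H g h) (format "''[' g ,  h ]").

Lemma rmemZ a g : mem g -> mem (a *: g).
Proof. by move=> Hg; rewrite -[_ *: _]addr0; exact: rmemD Hg (rmem0 H). Qed.

Lemma rmemB g h : mem g -> mem h -> mem (g - h).
Proof. by move=> Hg Hh; rewrite addrC -scaleN1r; exact: rmemD. Qed.

Lemma rdot0l h : mem h -> '[0, h] = 0.
Proof.
move=> Hh; have := rdotD 1 (rmem0 H) (rmem0 H) Hh.
by rewrite scaler0 addr0 mul1r => /eqP; rewrite -subr_eq0 opprD addNKr oppr_eq0 => /eqP.
Qed.

Lemma rdotDr a g h h' : mem g -> mem h -> mem h' ->
  '[g, a *: h + h'] = a * '[g, h] + '[g, h'].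
Proof.
move=> Hg Hh Hh'; have Hs := rmemD a Hh Hh'.
by rewrite rdotC// rdotD// (rdotC Hh)// (rdotC Hh').
Qed.

Lemma rdot0r g : mem g -> '[g, 0] = 0.
Proof. by move=> Hg; rewrite rdotC ?rdot0l//; exact: rmem0. Qed.

Lemma rdotZl a g h : mem g -> mem h -> '[a *: g, h] = a * '[g, h].
Proof.
move=> Hg Hh; rewrite -[a *: g]addr0 rdotD//; last exact: rmem0.
by rewrite rdot0l// addr0.
Qed.

Lemma rdotZr a g h : mem g -> mem h -> '[g, a *: h] = a * '[g, h].
Proof.
move=> Hg Hh; rewrite -[a *: h]addr0 rdotDr//; last exact: rmem0.
by rewrite rdot0r// addr0.
Qed.

Lemma rdotBl g g' h : mem g -> mem g' -> mem h ->
  '[g - g', h] = '[g, h] - '[g', h].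
Proof.
by move=> Hg Hg' Hh; rewrite addrC -scaleN1r rdotD// mulN1r addrC.
Qed.

Lemma rdotBr g h h' : mem g -> mem h -> mem h' ->
  '[g, h - h'] = '[g, h] - '[g, h'].
Proof.
by move=> Hg Hh Hh'; rewrite addrC -scaleN1r rdotDr// mulN1r addrC.
Qed.

Lemma rdotBB g g' h h' : mem g -> mem g' -> mem h -> mem h' ->
  '[g - g', h - h'] = '[g, h] - '[g, h'] - ('[g', h] - '[g', h']).
Proof.
by move=> Hg Hg' Hh Hh'; rewrite rdotBl ?rdotBr//; exact: rmemB.
Qed.

Lemma rdot_sqD a g h : mem g -> mem h ->
  '[a *: g + h, a *: g + h] = a ^+ 2 * '[g, g] + 2 * a * '[g, h] + '[h, h].
Proof.
move=> Hg Hh; have Hs := rmemD a Hg Hh.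
by rewrite rdotD// !rdotDr// (rdotC Hh Hg); ring.
Qed.

(** For [h] of positive norm, expand the square norm of [<h, h> g - <g, h> h]: it is [<h, h>] times
    the gap between the two sides. *)
Lemma rdot_CauchySchwarz g h : mem g -> mem h ->
  '[g, h] ^+ 2 <= '[g, g] * '[h, h].
Proof.
move=> Hg Hh; have := rdot_ge0 Hh; rewrite le_eqVlt => /orP[/eqP h0|h0].
  by rewrite (rdot_eq0 Hh (esym h0)) !rdot0r ?expr0n ?mulr0//; exact: rmem0.
have := rdot_ge0 (rmemD '[h, h] Hg (rmemZ (- '[g, h]) Hh)).
have Hz := rmemZ (- '[g, h]) Hh; rewrite rdot_sqD// !rdotZr// rdotZl//.
move=> q; rewrite -(ler_pM2l h0) -subr_ge0; apply: le_trans q _.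
by rewrite le_eqVlt; apply/orP; left; apply/eqP; ring.
Qed.

Lemma rdot_section s : '[k s, k s] = k s s.
Proof. by rewrite rreproducing//; exact: rmem_section. Qed.

(** Cauchy-Schwarz against the section [k s]. This continuity of evaluations yields both pointwise
    limits and, for bounded [k], bounded members. *)
Lemma rkhs_eval_bound g s : mem g -> g s ^+ 2 <= '[g, g] * k s s.
Proof.
move=> Hg; rewrite -(rreproducing s Hg) -(rdot_section s).
exact: rdot_CauchySchwarz Hg (rmem_section H s).
Qed.

(* The representer minimises [<h, h> - 2 phi h] over [M]; the parallelogram
   identity makes a minimising sequence Cauchy. *)
Lemma rkhs_riesz (M : set (S -> R)) (phi : (S -> R) -> R) (C : R) :
  M `<=` mem -> M 0 ->
  (forall a g h, M g -> M h -> M (a *: g + h)) ->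
  (forall (u : nat -> S -> R) l, (forall n, M (u n)) -> mem l ->
    (fun n => Num.sqrt '[u n - l, u n - l]) @ \oo --> (0 : R) -> M l) ->
  (forall a g h, M g -> M h -> phi (a *: g + h) = a * phi g + phi h) ->
  (forall h, M h -> phi h ^+ 2 <= C * '[h, h]) ->
  exists2 m, M m & forall h, M h -> '[h, m] = phi h.
Proof.
move=> MH M0 MD Mcl phiD phiC.
pose J h := '[h, h] - 2 * phi h.
have JC h : M h -> - `|C| <= J h.
  move=> Mh; rewrite /J leNgt; apply/negP => Jlt.
  have q0 := rdot_ge0 (MH _ Mh).
  have := phiC _ Mh; rewrite leNgt => /negP; apply.
  have C0 : 0 <= `|C| := normr_ge0 _.
  have CC : C * '[h, h] <= `|C| * '[h, h] by rewrite ler_wpM2r// ler_norm.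
  apply: le_lt_trans CC _.
  have : `|C| + '[h, h] < 2 * phi h by lra.
  move: C0 q0; set c := `|C|; set q := '[h, h]; set p := phi h => c0 q0 cq.
  (* This says [4 c q <= (c + q)^2], and [c + q < 2 p] with [c + q] nonnegative then gives
     [c q < p^2]. *)
  have : 0 <= (c - q) ^+ 2 by exact: sqr_ge0.
  by nra.
have Jinf : has_inf (J @` M).
  by split; [exists (J 0), 0|exists (- `|C|) => _ [h Mh <-]; exact: JC].
set I := inf (J @` M).
have IJ h : M h -> I <= J h by move=> Mh; apply: ge_inf; [exact: Jinf.2|exists h].
have /choice[u uP] n : exists h, M h /\ J h < I + n.+1%:R^-1.
  have [|_ [h Mh <-] Jh] := @inf_adherent _ (J @` M) n.+1%:R^-1 _ Jinf.
    by rewrite invr_gt0.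
  by exists h.
have Mu n : M (u n) by case: (uP n).
have Hu n : mem (u n) by exact/MH/Mu.
have Ju n : J (u n) < I + n.+1%:R^-1 by case: (uP n).
have parallelogram m n :
    '[u m - u n, u m - u n] <= 2 * m.+1%:R^-1 + 2 * n.+1%:R^-1.
  (* The midpoint lies in [M], so [J] is at least [I] there, while [J (u m)] and [J (u n)] exceed
     [I] by less than [1/(m+1)] and [1/(n+1)]. *)
  have Mmn : M (2^-1 *: u m + 2^-1 *: u n).
    by apply: (MD) => //; rewrite -[_ *: _]addr0; exact: MD.
  have := IJ _ Mmn; have := Ju m; have := Ju n.
  rewrite /J phiD//; last by rewrite -[_ *: _]addr0; exact: MD.
  have -> : phi (2^-1 *: u n) = 2^-1 * phi (u n).
    have phi0 : phi 0 = 0.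
      have := phiD 1 0 0 M0 M0; rewrite scaler0 addr0 mul1r => /eqP.
      by rewrite -subr_eq0 opprD addNKr oppr_eq0 => /eqP.
    by rewrite -[_ *: _]addr0 phiD// phi0 addr0.
  have Hz := rmemZ 2^-1 (Hu n).
  rewrite rdot_sqD// !rdotZr// rdotZl//.
  have -> : u m - u n = (-1) *: u n + u m by rewrite scaleN1r addrC.
  rewrite rdot_sqD// (rdotC (Hu n) (Hu m)).
  move: (m.+1%:R^-1) (n.+1%:R^-1) ('[u m, u m]) ('[u n, u n]) ('[u m, u n]).
  by rewrite !expr2 => x y p q r; lra.
have /= [e e0|l Hl ul] := rcomplete Hu.
  (* Chosen so that [1/(j+1) < e^2/4] for [j >= N]; the parallelogram bound is then below [e^2]. *)
  pose N := Num.truncn (4 / e ^+ 2).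
  have NP : 4 / e ^+ 2 < N.+1%:R by exact: Num.Theory.truncnS_gt.
  exists N => m n Nm Nn.
  rewrite -(ltr_pXn2r (n := 2)) ?nnegrE ?sqrtr_ge0 ?ltW// sqr_sqrtr; last first.
    by apply: rdot_ge0; exact: rmemB.
  apply: le_lt_trans (parallelogram m n) _.
  have e2 : 0 < e ^+ 2 by rewrite exprn_gt0.
  have inv j : (N <= j)%N -> j.+1%:R^-1 < e ^+ 2 / 4.
    move=> Nj; rewrite -[ltRHS]invrK ltf_pV2 ?posrE ?invr_gt0 ?divr_gt0// invf_div.
    by apply: lt_le_trans NP _; rewrite ler_nat.
  have := inv _ Nm; have := inv _ Nn.
  by move: (m.+1%:R^-1) (n.+1%:R^-1) (e ^+ 2) => x y z; lra.
exists l; first exact: Mcl ul.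
move=> h Mh; have Hh := MH _ Mh.
have uh : (fun n => '[u n, h]) @ \oo --> '[l, h].
  apply/cvgrPdist_le => e e0.
  have ul' : (fun n => Num.sqrt '[u n - l, u n - l] * Num.sqrt '[h, h]) @ \oo --> (0 : R).
    by rewrite -(mul0r (Num.sqrt '[h, h])); apply: cvgM ul _; exact: cvg_cst.
  move/cvgrPdist_le : ul' => /(_ e e0); apply: filterS => n.
  rewrite sub0r normrN ger0_norm ?mulr_ge0 ?sqrtr_ge0//; apply: le_trans.
  rewrite distrC -rdotBl//.
  have Hul : mem (u n - l) by exact: rmemB.
  rewrite -sqrtrM ?rdot_ge0// -sqrtr_sqr ler_wsqrtr//.
  exact: rdot_CauchySchwarz.
pose d := '[l, h] - phi h; pose q := '[h, h].
have q0 : 0 <= q by exact: rdot_ge0.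
have q1 : 0 < q + 1 by lra.
suff : d ^+ 2 <= 0.
  by rewrite real_exprn_even_le0 ?num_real//= subr_eq0 (rdotC Hl)// => /eqP.
(* First-order optimality of [l] in the direction [h]: [t^2 q + 2 t d] must be nonnegative for every
   [t]. This [t] is close to the minimiser [- d / q], the added 1 covering [q = 0], and makes the
   expression a nonpositive multiple of [d^2]. *)
pose t := - d / (q + 1).
have uth n : 0 <= t ^+ 2 * q + 2 * t * ('[u n, h] - phi h) + n.+1%:R^-1.
  have := IJ _ (MD t _ _ Mh (Mu n)); have := Ju n.
  rewrite /J phiD// rdot_sqD// (rdotC Hh)// -/q.
  by move: (n.+1%:R^-1) => x ? ?; lra.
have tq : 0 <= t ^+ 2 * q + 2 * t * d + 0.
  have cv : (fun n => t ^+ 2 * q + 2 * t * ('[u n, h] - phi h) + n.+1%:R^-1)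
      @ \oo --> t ^+ 2 * q + 2 * t * d + 0.
    apply: cvgD; last exact: cvg_harmonic.
    apply: cvgD; first exact: cvg_cst.
    by apply: cvgM; [exact: cvg_cst|apply: cvgB => //; exact: cvg_cst].
  by apply: (ler_cvg_to (cvg_cst 0) cv); exact: nearW.
have tE : t * (q + 1) = - d by rewrite /t divfK// gt_eqF.
have : (t ^+ 2 * q + 2 * t * d) * (q + 1) ^+ 2 = - d ^+ 2 * (q + 2).
  transitivity ((t * (q + 1)) ^+ 2 * q + 2 * (t * (q + 1)) * d * (q + 1)); first by ring.
  by rewrite tE; ring.
have : 0 <= (t ^+ 2 * q + 2 * t * d) * (q + 1) ^+ 2.
  by rewrite mulr_ge0 ?sqr_ge0//; lra.
move=> + e; rewrite {}e mulNr oppr_ge0 => dq.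
by rewrite -(@pmulr_lle0 _ (q + 2))//; lra.
Qed.

Lemma rkhs_norm_cvg_pointwise (u : nat -> S -> R) l s :
  (forall n, mem (u n)) -> mem l ->
  (fun n => Num.sqrt '[u n - l, u n - l]) @ \oo --> (0 : R) ->
  (fun n => u n s) @ \oo --> l s.
Proof.
move=> Hu Hl ul; apply/cvgrPdist_le => e e0.
have : (fun n => Num.sqrt '[u n - l, u n - l] * Num.sqrt (k s s)) @ \oo
    --> (0 : R).
  by rewrite -(mul0r (Num.sqrt (k s s))); apply: cvgM ul _; exact: cvg_cst.
move/cvgrPdist_le => /(_ e e0); apply: filterS => n.
have Hd := rmemB (Hu n) Hl.
rewrite sub0r normrN ger0_norm ?mulr_ge0 ?sqrtr_ge0//; apply: le_trans.
rewrite distrC -sqrtrM ?rdot_ge0// -sqrtr_sqr ler_wsqrtr//.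
exact: rkhs_eval_bound s Hd.
Qed.

End rkhs_theory.

(** * Measurability and boundedness of the members of the RKHS *)

Section measurable_rkhs.
Context (R : realType) d (S : measurableType d) (k : S -> S -> R).
Hypothesis kernel_k : is_kernel k.
Variable H : rkhs k.

(* The measurable members form a closed subspace containing every section of
   [k], hence their orthogonal complement is trivial. *)
Lemma rkhs_measurable h : rmem H h -> measurable_fun [set: S] h.
Proof.
have [mk _ _ _] := kernel_k.
move=> Hh; pose M := [set g | rmem H g /\ measurable_fun [set: S] g].
(* The representer of [<., h>] on [M] is the orthogonal projection of [h]; pairing with the
   sections, which lie in [M], shows that it is [h] itself. *)
have [] := @rkhs_riesz _ _ _ H M (fun g => rdot H g h) (rdot H h h).
- by move=> g [].
- by split; [exact: rmem0|exact: measurable_cst].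
- move=> a g g' [Hg mg] [Hg' mg']; split; first exact: rmemD.
  by apply: measurable_funD => //; exact: measurable_funM.
- move=> u l Mu Hl ul; split=> //.
  apply: (@measurable_fun_cvg _ _ _ _ u) => [n|s _]; first by have [] := Mu n.
  by apply: rkhs_norm_cvg_pointwise ul => // n; have [] := Mu n.
- by move=> a g g' [Hg _] [Hg' _]; exact: rdotD.
- by move=> g [Hg _]; rewrite mulrC; exact: rdot_CauchySchwarz.
move=> m [Hm mm] mh; suff -> : h = m by [].
apply/funext => s; rewrite -(rreproducing s Hh) -(rreproducing s Hm).
rewrite (rdotC Hh (rmem_section H s)) (rdotC Hm (rmem_section H s)) mh//.
split; first exact: rmem_section.
exact: (measurableT_comp mk (measurable_pair1 s)).
Qed.

Lemma rkhs_bounded h : rmem H h -> exists C, forall s, `|h s| <= C.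
Proof.
have [_ [M kM] _ _] := kernel_k.
move=> Hh; exists (Num.sqrt (rdot H h h * M)) => s.
rewrite -sqrtr_sqr ler_wsqrtr//; apply: le_trans (rkhs_eval_bound s Hh) _.
by rewrite ler_wpM2l ?rdot_ge0// (le_trans (ler_norm _)).
Qed.

End measurable_rkhs.

(** * Integrals against a charge that comes from a finite measure *)

Section charge_integral_measure.
Context (R : realType) d (T : measurableType d).

Variable mu : {finite_measure set T -> \bar R}.

(** The negative set [N] of a nonnegative measure is null, so the negative part vanishes and the
    positive part is [mu]. The decomposition is arbitrary because [charge_integral] picks one by
    choice. *)
Lemma Rintegral_jordan_measure P N
    (nuPN : hahn_decomposition (charge_of_finite_measure mu) P N) (h : T -> R) :
  \int[jordan_pos nuPN]_x h x - \int[jordan_neg nuPN]_x h x = \int[mu]_x h x.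
Proof.
have [[mP posP] [mN negN] PN1 PN0] := nuPN.
have muN A : measurable A -> mu (A `&` N) = 0%E.
  move=> mA; apply/eqP; rewrite eq_le measure_ge0 andbT.
  by apply: negN; [exact: measurableI|exact: subIsetr].
have neg0 : (\int[jordan_neg nuPN]_x (h x)%:E = 0)%E.
  rewrite (@eq_measure_integral _ _ _ _ mzero); first exact: integral_measure_zero.
  move=> A mA _; apply: etrans (etrans (jordan_negE nuPN A) (cjordan_negE nuPN A)) _.
  rewrite /crestr0 mem_set// /crestr.
  by rewrite -[LHS]/(- mu (A `&` N))%E muN// oppe0.
rewrite /Rintegral neg0 subr0; congr fine; apply: eq_measure_integral => A mA _.
apply: etrans (etrans (jordan_posE nuPN A) (cjordan_posE nuPN A)) _.
rewrite /crestr0 mem_set// /crestr.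
rewrite -[LHS]/(mu (A `&` P)).
rewrite -[in RHS](setIT A) -PN1 setIUr measureU//; try exact: measurableI.
  by rewrite -[X in _ = (_ + X)%E]/(mu (A `&` N)) muN// adde0.
by rewrite setIACA PN0 setI0.
Qed.

Lemma charge_integral_measure (h : T -> R) :
  charge_integral (charge_of_finite_measure mu) h = \int[mu]_x h x.
Proof. exact: Rintegral_jordan_measure. Qed.

End charge_integral_measure.

(** * Bounded measurable functions, all integrable for a probability *)

Definition bounded_mfun (R : realType) d (T : measurableType d) (h : T -> R) :=
  measurable_fun [set: T] h /\ exists M, forall x, `|h x| <= M.

Section bounded_mfun_theory.
Context (R : realType) d (T : measurableType d).
Implicit Types (m : probability T R) (h g : T -> R).

Lemma bounded_mfun_cst (c : R) : bounded_mfun (cst c : T -> R).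
Proof. by split=> //; exists `|c|. Qed.

Lemma bounded_mfunD h g : bounded_mfun h -> bounded_mfun g -> bounded_mfun (h \+ g).
Proof.
move=> [mh [M hM]] [mg [N gN]]; split; first exact: measurable_funD.
by exists (M + N) => x; rewrite (le_trans (ler_normD _ _))// lerD.
Qed.

Lemma bounded_mfunM h g : bounded_mfun h -> bounded_mfun g -> bounded_mfun (h \* g).
Proof.
move=> [mh [M hM]] [mg [N gN]]; split; first exact: measurable_funM.
by exists (M * N) => x; rewrite normrM ler_pM.
Qed.

Lemma bounded_mfun_integrable m h : bounded_mfun h ->
  m.-integrable [set: T] (EFin \o h).
Proof.
move=> [mh [M hM]]; apply: measurable_bounded_integrable => //.
  by rewrite (le_lt_trans (probability_le1 _ _)) ?ltry.
exists M; split; first exact: num_real.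
by move=> x Mx t _ /=; rewrite (le_trans (hM t))// ltW.
Qed.

Lemma probability_Rintegral_cst m (c : R) : \int[m]_x cst c x = c.
Proof. by rewrite Rintegral_cst// [X in fine X]probability_setT mulr1. Qed.

Lemma Rintegral_le_bound m h M : measurable_fun [set: T] h ->
  (forall x, `|h x| <= M) -> `|\int[m]_x h x| <= M.
Proof.
move=> mh hM; have hi : m.-integrable [set: T] (EFin \o h).
  by apply: bounded_mfun_integrable; split => //; exists M.
have Mi : m.-integrable [set: T] (EFin \o cst M).
  by apply: bounded_mfun_integrable; exact: bounded_mfun_cst.
rewrite (le_trans (le_normr_Rintegral _ hi))//.
rewrite -[leRHS](probability_Rintegral_cst m).
by apply: le_Rintegral => //; exact: integrable_norm hi.
Qed.

Lemma probability_RintegralD_cst m h M : bounded_mfun h ->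
  \int[m]_x (h x + M) = \int[m]_x h x + M.
Proof.
move=> hb; rewrite RintegralD//; try exact: bounded_mfun_integrable.
  by rewrite (probability_Rintegral_cst m).
by apply: bounded_mfun_integrable; exact: bounded_mfun_cst.
Qed.

Lemma RintegralDZ m (a : R) g h : bounded_mfun g -> bounded_mfun h ->
  \int[m]_x (g + a *: h) x = \int[m]_x g x + a * \int[m]_x h x.
Proof.
move=> /(bounded_mfun_integrable m) gi /(bounded_mfun_integrable m) hi.
rewrite -RintegralZl// -RintegralD//.
exact: (integrableZl measurableT a hi).
Qed.

Lemma bounded_mfun_EFin_Rintegral m h : bounded_mfun h ->
  (\int[m]_x (h x)%:E)%E = (\int[m]_x h x)%:E.
Proof.
move=> /(bounded_mfun_integrable m) hi; rewrite /Rintegral fineK//.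
exact: integrable_fin_num hi.
Qed.

Lemma ae_eq_Rintegral m g h : bounded_mfun g -> bounded_mfun h ->
  {ae m, forall x, g x = h x} -> \int[m]_x g x = \int[m]_x h x.
Proof.
move=> [mg _] [mh _] gh; congr fine; apply: ae_eq_integral => //.
- exact/measurable_EFinP.
- exact/measurable_EFinP.
- by apply: filterS gh => x /= ->.
Qed.

End bounded_mfun_theory.

(** * Integration against measurable families of probabilities *)

Section probability_family.
Context (R : realType) d1 d2 (T1 : measurableType d1) (T2 : measurableType d2).
Variables (K : T1 -> probability T2 R).
Hypothesis mK : forall U, measurable U -> measurable_fun [set: T1] (fun t => K t U).

Lemma measurable_family_giry : measurable_fun [set: T1] (K : T1 -> giry T2 R).
Proof. by apply: measurable_giry_codensity => // B mB; exact: mK. Qed.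

Lemma bounded_mfun_family_Rintegral h : bounded_mfun h ->
  bounded_mfun (fun t => \int[K t]_x h x).
Proof.
move=> hb; have [mh [M hM]] := hb; split; last first.
  by exists M => t; exact: Rintegral_le_bound.
(* Adding the bound [M] makes the integrand nonnegative, as measurability of integrals against a
   kernel requires. *)
rewrite (_ : (fun _ => _) = (fun t => \int[K t]_x (h x + M) - M)); last first.
  by apply/funext => t; rewrite probability_RintegralD_cst// addrK.
apply: measurable_funB => //; apply: (measurableT_comp (fine_measurable _)) => //.
apply: measurable_fun_integral_kernel => //.
  by move=> z; rewrite lee_fin -lerBlDr sub0r; have := hM z; rewrite ler_norml => /andP[].
by apply/measurable_EFinP; exact: measurable_funD.
Qed.

Variables (m : probability T1 R) (m2 : probability T2 R).
Hypothesis m2E : forall U, measurable U -> m2 U = (\int[m]_t K t U)%E.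

(** On measurable sets [m2] is the Giry bind of [m] with [K], for which this is the integration
    formula. *)
Lemma ge0_integral_family (h : T2 -> \bar R) : measurable_fun [set: T2] h ->
  (forall x, 0 <= h x)%E ->
  (\int[m2]_x h x = \int[m]_t \int[K t]_x h x)%E.
Proof.
move=> mh h0; have mf := measurable_family_giry.
have := @giry_int_bind _ _ _ _ _ m _ mf h mh h0.
rewrite {2 3}/giry_int => <-; apply: eq_measure_integral => A mA _.
apply: etrans (m2E mA) _; apply/esym.
rewrite -[LHS]/(giry_int (giry_map mf m) (giry_ev ^~ A)) giry_int_map//.
exact: measurable_giry_ev.
Qed.

Lemma Rintegral_family h : bounded_mfun h ->
  \int[m2]_x h x = \int[m]_t \int[K t]_x h x.
Proof.
move=> hb; have [mh [M hM]] := hb; apply: (addIr M).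
have bt := bounded_mfun_family_Rintegral hb.
rewrite -!probability_RintegralD_cst//.
have hMb : bounded_mfun (fun x => h x + M).
  exact: bounded_mfunD hb (bounded_mfun_cst _ _).
rewrite /Rintegral ge0_integral_family//; last 2 first.
  by apply/measurable_EFinP; case: hMb.
  by move=> x; rewrite lee_fin -lerBlDr sub0r; have := hM x; rewrite ler_norml => /andP[].
congr fine; apply: eq_integral => t _.
by rewrite bounded_mfun_EFin_Rintegral// probability_RintegralD_cst.
Qed.

End probability_family.

Section double_integral.
Context (R : realType) d1 d2 (T1 : measurableType d1) (T2 : measurableType d2).
Variables (k : T1 * T2 -> R).
Hypothesis kb : bounded_mfun k.
Local Notation pro1 m1 m2 := ((m1 \x m2)%E : probability (T1 * T2)%type R).

Lemma bounded_mfun_section1 x : bounded_mfun (fun y => k (x, y)).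
Proof.
have [mk [M kM]] := kb; split; last by exists M.
exact: (measurableT_comp mk (measurable_pair1 x)).
Qed.

Lemma bounded_mfun_section2 y : bounded_mfun (fun x => k (x, y)).
Proof.
have [mk [M kM]] := kb; split; last by exists M.
exact: (measurableT_comp mk (measurable_pair2 y)).
Qed.

Lemma Rintegral_prod1 (m1 : probability T1 R) (m2 : probability T2 R) :
  \int[(m1 \x m2)%E]_z k z = \int[m1]_x \int[m2]_y k (x, y).
Proof.
have ki : (m1 \x m2)%E.-integrable [set: T1 * T2] (EFin \o k).
  exact: (@bounded_mfun_integrable _ _ _ (pro1 m1 m2)).
rewrite /Rintegral -(integral12_prod_meas1 ki); congr fine.
apply: eq_integral => x _.
by rewrite -bounded_mfun_EFin_Rintegral//; exact: bounded_mfun_section1.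
Qed.

(** By Fubini the iterated integral is one integral against [K1 t \x K2 t], a measurable family
    since the product map of the Giry monad is measurable. *)
Lemma bounded_mfun_family_double d (T : measurableType d)
    (K1 : T -> probability T1 R) (K2 : T -> probability T2 R) :
  (forall U, measurable U -> measurable_fun [set: T] (fun t => K1 t U)) ->
  (forall U, measurable U -> measurable_fun [set: T] (fun t => K2 t U)) ->
  bounded_mfun (fun t => \int[K1 t]_x \int[K2 t]_y k (x, y)).
Proof.
move=> mK1 mK2.
have := @bounded_mfun_family_Rintegral _ _ _ _ _ (fun t => pro1 (K1 t) (K2 t)).
rewrite (_ : (fun t => \int[K1 t]_x _) =
   (fun t => \int[pro1 (K1 t) (K2 t)]_z k z)); last first.
  by apply/funext => t; rewrite -Rintegral_prod1.
apply=> // U mU.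
have mp : measurable_fun [set: T] (fun t => ((K1 t : giry T1 R), (K2 t : giry T2 R))).
  by apply/measurable_fun_pairP; split; exact: measurable_family_giry.
exact: (measurableT_comp (measurable_giry_ev mU)
  (measurableT_comp (@measurable_giry_prod _ _ _ _ R) mp)).
Qed.

End double_integral.

(** * Change of variables along a density *)

Section density.
Context (R : realType) d (T : measurableType d).
Variables (q : probability T R) (mu : {sigma_finite_measure set T -> \bar R}).
Variable p : T -> \bar R.
Hypothesis mp : measurable_fun [set: T] p.
Hypothesis qE : forall A, measurable A -> q A = (\int[mu]_(x in A) p x)%E.

(** The density [p] agrees almost everywhere with the Radon-Nikodym derivative of [q], both having
    integral [q A] over each measurable [A]. *)
Lemma integral_density (h : T -> \bar R) : q.-integrable [set: T] h ->
  (\int[q]_x h x = \int[mu]_x (h x * p x))%E.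
Proof.
move=> hi; have qmu : q `<< mu.
  apply/null_content_dominatesP => A mA muA0; rewrite qE//.
  by apply: null_set_integral => //; exact: measurable_funTS.
rewrite -(Radon_Nikodym_change_of_variables qmu)//.
have mh := measurable_int _ hi.
have RNi := @Radon_Nikodym_integrable _ _ _ (charge_of_finite_measure q) mu qmu.
have mRN := measurable_int _ RNi.
apply: ae_eq_integral => //; try exact: emeasurable_funM.
apply: ae_eqe_mul2l; apply: integral_ae_eq => //.
move=> A _ mA; rewrite -[RHS]qE//; apply/esym.
exact: (@Radon_Nikodym_integral _ _ _ (charge_of_finite_measure q) mu A qmu mA).
Qed.

End density.

(** * Barycenters and nonnegative combinations of probabilities *)

Section family_mixture.
Context (R : realType) d1 d2 (T1 : measurableType d1) (T2 : measurableType d2).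
Variables (m : probability T1 R) (K : T1 -> probability T2 R).
Hypothesis mK : forall U, measurable U -> measurable_fun [set: T1] (fun t => K t U).

(** The mean measure, encoded as a Giry bind so as to inherit a measure structure; [barycenterE]
    recovers its values on measurable sets. *)
Definition barycenter : set T2 -> \bar R := giry_bind m (measurable_family_giry mK).

Lemma barycenterE U : measurable U -> barycenter U = (\int[m]_t K t U)%E.
Proof.
move=> mU; rewrite /barycenter.
rewrite -[LHS]/(giry_int (giry_map (measurable_family_giry mK) m) (giry_ev ^~ U)).
by rewrite giry_int_map//; exact: measurable_giry_ev.
Qed.

HB.instance Definition _ := Measure.on barycenter.

Let barycenter_setT : barycenter [set: T2] = 1%E.
Proof.
rewrite barycenterE// (eq_integral (cst 1%E)) => [|t _]; last exact: probability_setT.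
by rewrite integral_cst// mul1e; exact: probability_setT.
Qed.

HB.instance Definition _ :=
  @Measure_isProbability.Build _ _ R barycenter barycenter_setT.

End family_mixture.

Section measure_combination.
Context (R : realType) d (T : measurableType d).
Variables (p q : probability T R) (a : {nonneg R}).

(** With [a] nonnegative this is a finite measure, so injectivity of the embedding can be applied
    without handling a Jordan decomposition with two nonzero parts. *)
Definition measure_combination : set T -> \bar R := measure_add p (mscale a q).

HB.instance Definition _ := Measure.on measure_combination.

Lemma measure_combinationE A :
  measure_combination A = (p A + a%:num%:E * q A)%E.
Proof. by rewrite /measure_combination measure_addE. Qed.

Let measure_combination_fin : fin_num_fun measure_combination.
Proof.
by move=> A mA; rewrite measure_combinationE fin_numD ?fin_numM ?fin_num_measure.
Qed.

HB.instance Definition _ :=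
  @Measure_isFinite.Build _ _ _ measure_combination measure_combination_fin.

Lemma Rintegral_measure_combination h : bounded_mfun h ->
  \int[measure_combination]_x h x = \int[p]_x h x + a%:num * \int[q]_x h x.
Proof.
move=> hb; have [/measurable_EFinP mh _] := hb.
have ge0E (g : T -> \bar R) : measurable_fun [set: T] g -> (forall x, 0 <= g x)%E ->
    (\int[measure_combination]_x g x =
     \int[p]_x g x + a%:num%:E * \int[q]_x g x)%E.
  move=> mg g0; rewrite [LHS]ge0_integral_measure_add//.
  by rewrite ge0_integral_mscale.
rewrite /Rintegral (integralE measure_combination) ge0E//; last exact: measurable_funepos.
rewrite ge0E//; last exact: measurable_funeneg.
rewrite (integralE p) (integralE q).
have hi m := bounded_mfun_integrable m hb.
have fp m := integrable_fin_num measurableT (integrable_funepos measurableT (hi m)).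
have fn m := integrable_fin_num measurableT (integrable_funeneg measurableT (hi m)).
rewrite -(fineK (fp p)) -(fineK (fp q)) -(fineK (fn p)) -(fineK (fn q)).
by rewrite -!EFinM -!EFinD/=; ring.
Qed.

End measure_combination.

(** * Kernel mean embeddings, their expectation and their covariance *)

Section kernel_mean_embedding.
Context (R : realType) d (S : measurableType d) (k : S -> S -> R).
Hypothesis kernel_k : is_kernel k.
Variable H : rkhs k.
Implicit Types (p q : probability S R) (h : S -> R).

Lemma kernel_bounded_mfun : bounded_mfun (fun z : S * S => k z.1 z.2).
Proof. by have [mk [M kM] _ _] := kernel_k; split => //; exists M. Qed.

Lemma rmem_bounded_mfun h : rmem H h -> bounded_mfun h.
Proof.
move=> Hh; split; first exact: rkhs_measurable Hh.
exact: rkhs_bounded Hh.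
Qed.

Definition embedding p : S -> R := mean_embedding k (charge_of_finite_measure p).

Lemma embeddingE p t : embedding p t = \int[p]_s k s t.
Proof. exact: charge_integral_measure. Qed.

(** Integration against [p] is a bounded functional on [H] by the evaluation bound. Testing its
    Riesz representer on sections of [k] identifies it with the embedding. *)
Lemma embedding_riesz p :
  rmem H (embedding p) /\ forall h, rmem H h -> rdot H h (embedding p) = \int[p]_s h s.
Proof.
have [_ [M kM] ksym _] := kernel_k.
have [||||a g h Hg Hh|h Hh|m Hm mE] :=
  @rkhs_riesz _ _ _ H (rmem H) (fun h => \int[p]_s h s) M.
- by [].
- exact: rmem0.
- by move=> *; exact: rmemD.
- by [].
- have gi := bounded_mfun_integrable p (rmem_bounded_mfun Hg).
  have hi := bounded_mfun_integrable p (rmem_bounded_mfun Hh).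
  rewrite -RintegralZl// -RintegralD//.
  exact: (integrableZl measurableT a gi).
(* Written as a square, the bound reduces to a pointwise one on [h]; the value [k point point]
   serves to show [0 <= M]. *)
- rewrite -[leRHS]sqr_sqrtr; last first.
    rewrite mulr_ge0 ?rdot_ge0// (le_trans (normr_ge0 (k point point)))//.
  rewrite -[leLHS]real_normK ?num_real// lerXn2r ?nnegrE ?sqrtr_ge0//.
  apply: Rintegral_le_bound; first by have [] := rmem_bounded_mfun Hh.
  move=> s; rewrite -sqrtr_sqr ler_wsqrtr//.
  apply: le_trans (rkhs_eval_bound s Hh) _.
  by rewrite mulrC ler_wpM2r ?rdot_ge0// (le_trans (ler_norm _)).
suff <- : m = embedding p by split.
apply/funext => t; rewrite embeddingE -(rreproducing t Hm) rdotC//; last first.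
  exact: rmem_section.
rewrite mE; last exact: rmem_section.
by apply: eq_Rintegral => s _; rewrite ksym.
Qed.

Lemma rmem_embedding p : rmem H (embedding p).
Proof. by have [] := embedding_riesz p. Qed.

Lemma rdot_embedding p h : rmem H h -> rdot H h (embedding p) = \int[p]_s h s.
Proof. by have [_] := embedding_riesz p; exact. Qed.

Lemma rdot_embedding2 p q :
  rdot H (embedding p) (embedding q) = \int[q]_t \int[p]_s k s t.
Proof.
rewrite rdot_embedding//; last exact: rmem_embedding.
by apply: eq_Rintegral => t _; rewrite embeddingE.
Qed.

Lemma eq_embedding p q : (forall A, measurable A -> p A = q A) ->
  embedding p = embedding q.
Proof.
move=> pq; apply/funext => t; rewrite !embeddingE; congr fine.
by apply: eq_measure_integral => A mA _; exact: pq.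
Qed.

Section random.
Context dO (Omega : measurableType dO) (Pr : probability Omega R).

(** Exchanging integrals shows that the embedded barycenter satisfies the characterisation, so
    [xget] does not return its default. Two solutions have the same pairing with their difference,
    which is therefore zero. *)
Lemma rkhs_expectation_embedding (Q : Omega -> probability S R)
    (mQ : forall U, measurable U -> measurable_fun [set: Omega] (fun w => Q w U)) :
  rkhs_expectation Pr H (random_embedding k Q) = embedding (barycenter Pr mQ).
Proof.
have expE h : rmem H h ->
    (rdot H h (embedding (barycenter Pr mQ)))%:E =
    ('E_Pr[fun w => rdot H h (random_embedding k Q w)])%E.
  move=> Hh; have hb := rmem_bounded_mfun Hh; rewrite unlock rdot_embedding//.
  rewrite (Rintegral_family mQ (barycenterE Pr mQ))//.
  rewrite -bounded_mfun_EFin_Rintegral; last exact: bounded_mfun_family_Rintegral.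
  by apply: eq_integral => w _; rewrite -rdot_embedding.
have Hb := rmem_embedding (barycenter Pr mQ).
have [] := @xgetPex _ 0 [set m | rmem H m /\
    forall h, rmem H h -> (rdot H h m)%:E =
    ('E_Pr[fun w => rdot H h (random_embedding k Q w)])%E].
  by exists (embedding (barycenter Pr mQ)).
rewrite -/(rkhs_expectation Pr H (random_embedding k Q)).
set m := rkhs_expectation _ _ _ => Hm mE.
apply/eqP; rewrite -subr_eq0; apply/eqP.
have Hd := rmemB Hm Hb; apply: (rdot_eq0 Hd).
rewrite rdotBr//; apply/eqP; rewrite subr_eq0; apply/eqP.
by apply: EFin_inj; rewrite mE// expE.
Qed.

Lemma rkhs_ae_eq0 (A : Omega -> S -> R) : (forall w, rmem H (A w)) ->
  bounded_mfun (fun w => rdot H (A w) (A w)) ->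
  \int[Pr]_w rdot H (A w) (A w) = 0 -> {ae Pr, forall w, A w = 0}.
Proof.
move=> HA bA A0.
have : ae_eq Pr [set: Omega] (fun w => (rdot H (A w) (A w))%:E) (cst 0%E).
  apply/ae_eq_integral_abs => //.
    by apply/measurable_EFinP; have [] := bA.
  rewrite (eq_integral (fun w => (rdot H (A w) (A w))%:E)) => [|w _].
    by rewrite (bounded_mfun_EFin_Rintegral Pr bA) A0.
  by rewrite gee0_abs//= lee_fin; exact: rdot_ge0.
by apply: filterS => w /(_ Logic.I) [] /(rdot_eq0 (HA w)).
Qed.

(* The case of equality in the Cauchy-Schwarz inequality: the integral of
   [|A - a B|^2] vanishes for [a := sqrt v1 / sqrt v2]. *)
Lemma correlation1_proportional (A B : Omega -> S -> R) (v1 v2 c : R) :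
  (forall w, rmem H (A w)) -> (forall w, rmem H (B w)) ->
  bounded_mfun (fun w => rdot H (A w) (A w)) ->
  bounded_mfun (fun w => rdot H (A w) (B w)) ->
  bounded_mfun (fun w => rdot H (B w) (B w)) ->
  v1 = \int[Pr]_w rdot H (A w) (A w) ->
  v2 = \int[Pr]_w rdot H (B w) (B w) ->
  c = \int[Pr]_w rdot H (A w) (B w) ->
  c / (Num.sqrt v1 * Num.sqrt v2) = 1 ->
  exists2 a, 0 <= a & {ae Pr, forall w, A w = a *: B w}.
Proof.
move=> HA HB bAA bAB bBB v1E v2E cE corr.
(* Division by 0 yields 0, so a ratio equal to 1 excludes a zero denominator. *)
have s0 : Num.sqrt v1 * Num.sqrt v2 != 0.
  by apply: contra_eqN corr => /eqP ->; rewrite invr0 mulr0 eq_sym oner_eq0.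
have cs : c = Num.sqrt v1 * Num.sqrt v2.
  by rewrite -[LHS](divfK s0) corr mul1r.
have [s1 s2] : Num.sqrt v1 != 0 /\ Num.sqrt v2 != 0.
  by move: s0; rewrite mulf_eq0 negb_or => /andP[].
(* The square root of a negative number is 0 by convention, so a nonzero root forces [0 <= v]. *)
have sq (v : R) : Num.sqrt v != 0 -> Num.sqrt v ^+ 2 = v.
  move=> sv; rewrite sqr_sqrtr// leNgt; apply: contra sv => /ltW v0.
  by rewrite ler0_sqrtr.
pose a := Num.sqrt v1 / Num.sqrt v2.
have a0 : 0 <= a by rewrite divr_ge0 ?sqrtr_ge0.
exists a => //.
pose D w := rdot H (- a *: B w + A w) (- a *: B w + A w).
have DE : D = (fun w => a ^+ 2 * rdot H (B w) (B w) +
    (- (2 * a) * rdot H (A w) (B w) + rdot H (A w) (A w))).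
  by apply/funext => w; rewrite /D rdot_sqD// (rdotC (HB w))//; ring.
have bZ (x : R) g : bounded_mfun g -> bounded_mfun (fun w => x * g w) :> Prop.
  by move=> gb; apply: (bounded_mfunM (bounded_mfun_cst _ x) gb).
have bD : bounded_mfun D.
  by rewrite DE; apply: bounded_mfunD; [exact: bZ|apply: bounded_mfunD => //; exact: bZ].
have D0 : \int[Pr]_w D w = 0.
  have int g (gb : bounded_mfun g) := bounded_mfun_integrable Pr gb.
  rewrite DE RintegralD//; last 2 first.
    exact/int/bZ.
    by apply/int/bounded_mfunD => //; exact: bZ.
  rewrite RintegralD//; last 2 first.
    exact/int/bZ.
    exact/int.
  rewrite !RintegralZl//; try exact/int.
  rewrite -v1E -v2E -cE cs /a.
  move: (sq _ s1) (sq _ s2) (s2); move: (Num.sqrt v1) (Num.sqrt v2).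
  by move=> x y <- <- y0; field.
have HD w : rmem H (- a *: B w + A w) by exact: rmemD.
apply: filterS (rkhs_ae_eq0 HD bD D0) => w /eqP.
by rewrite scaleNr addrC subr_eq0 => /eqP.
Qed.

Lemma bounded_mfun_rdot_embedding (Q1 Q2 : Omega -> probability S R) :
  (forall U, measurable U -> measurable_fun [set: Omega] (fun w => Q1 w U)) ->
  (forall U, measurable U -> measurable_fun [set: Omega] (fun w => Q2 w U)) ->
  bounded_mfun (fun w => rdot H (embedding (Q1 w)) (embedding (Q2 w))).
Proof.
move=> mQ1 mQ2; have [_ _ ksym _] := kernel_k.
have := bounded_mfun_family_double kernel_bounded_mfun mQ2 mQ1.
congr bounded_mfun; apply/funext => w /=; rewrite rdot_embedding2.
by apply: eq_Rintegral => t _; apply: eq_Rintegral => s _; rewrite ksym.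
Qed.

(** Bilinearity gives four inner products of embeddings, with [m1] and [m2] regarded as constant
    families. *)
Lemma bounded_mfun_centered_rdot (Q1 Q2 : Omega -> probability S R)
    (m1 m2 : probability S R) :
  (forall U, measurable U -> measurable_fun [set: Omega] (fun w => Q1 w U)) ->
  (forall U, measurable U -> measurable_fun [set: Omega] (fun w => Q2 w U)) ->
  bounded_mfun (fun w => rdot H (embedding (Q1 w) - embedding m1)
                                (embedding (Q2 w) - embedding m2)).
Proof.
move=> mQ1 mQ2.
have cst_meas (m : probability S R) U : measurable U ->
    measurable_fun [set: Omega] (fun w => cst m w U) by move=> _; exact: measurable_cst.
have bN (g : Omega -> R) : bounded_mfun g -> bounded_mfun (fun w => - g w).
  move=> gb; have := bounded_mfunM (bounded_mfun_cst _ (-1)) gb.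
  by congr bounded_mfun; apply/funext => w /=; rewrite mulN1r.
have b12 := bounded_mfun_rdot_embedding mQ1 mQ2.
have b1m := bounded_mfun_rdot_embedding mQ1 (cst_meas m2).
have bm2 := bounded_mfun_rdot_embedding (cst_meas m1) mQ2.
have bmm := bounded_mfun_rdot_embedding (cst_meas m1) (cst_meas m2).
have := bounded_mfunD (bounded_mfunD b12 (bN _ b1m))
  (bN _ (bounded_mfunD bm2 (bN _ bmm))).
congr bounded_mfun; apply/funext => w /=.
by rewrite rdotBB//; exact: rmem_embedding.
Qed.

Lemma kcovE (Q1 Q2 : Omega -> probability S R)
    (mQ1 : forall U, measurable U -> measurable_fun [set: Omega] (fun w => Q1 w U))
    (mQ2 : forall U, measurable U -> measurable_fun [set: Omega] (fun w => Q2 w U)) :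
  kcov Pr H Q1 Q2 =
  \int[Pr]_w rdot H (embedding (Q1 w) - embedding (barycenter Pr mQ1))
                    (embedding (Q2 w) - embedding (barycenter Pr mQ2)).
Proof.
by rewrite /kcov (rkhs_expectation_embedding mQ1) (rkhs_expectation_embedding mQ2) unlock.
Qed.

End random.
End kernel_mean_embedding.

(** * Mixtures as barycenters of their components, and the smoothed kernel *)

Section mixture_theory.
Context (R : realType) dX dY (X : measurableType dX) (Y : measurableType dY).
Variables (nu : {sigma_finite_measure set Y -> \bar R}) (f : density_kernel X nu).
Implicit Types (P : probability X R) (A : set Y).

(* The law of density [f ^~ x], obtained as the mixture at a Dirac mass. *)
Local Notation component x := (mixture f \d_x).

Lemma measurable_density_kernel1 y : measurable_fun [set: X] (f y).
Proof. exact: (measurableT_comp (dk_measurable f) (measurable_pair1 y)). Qed.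

Lemma measurable_density_kernel2 x : measurable_fun [set: Y] (f ^~ x).
Proof. exact: (measurableT_comp (dk_measurable f) (measurable_pair2 x)). Qed.

Lemma componentE x A : component x A = (\int[nu]_(y in A) (f y x)%:E)%E.
Proof.
apply: eq_integral => y _; rewrite /mixture_density integral_dirac//.
  by rewrite diracT mul1e.
by apply/measurable_EFinP; exact: measurable_density_kernel1.
Qed.

(** The restriction to [A] is moved into the integrand, so that Tonelli applies on the whole
    product. *)
Let fA A (z : Y * X) := (f z.1 z.2 * \1_A z.1)%:E.

Let measurable_fA A : measurable A -> measurable_fun [set: Y * X] (fA A).
Proof.
move=> mA; apply/measurable_EFinP/measurable_funM; first exact: dk_measurable.
by apply: measurableT_comp => //; exact: measurable_indic.
Qed.

Let fA_ge0 A z : (0 <= fA A z)%E.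
Proof. by rewrite lee_fin mulr_ge0 ?dk_ge0. Qed.

Let componentA x A : component x A = (\int[nu]_y fA A (y, x))%E.
Proof.
rewrite componentE integral_mkcond epatch_indic.
by apply: eq_integral => y _; rewrite /fA EFinM.
Qed.

Lemma measurable_component A : measurable A ->
  measurable_fun [set: X] (fun x => component x A).
Proof.
move=> mA; rewrite (_ : (fun _ => _) = fubini_G nu (fA A)).
  by apply: measurable_fun_fubini_tonelli_G => //; exact: measurable_fA.
by apply/funext => x; rewrite componentA.
Qed.

(** By Tonelli, the mixture is the barycenter of its components under [P]; the results on measurable
    families thus apply to it. *)
Lemma mixtureE P A : measurable A -> mixture f P A = (\int[P]_x component x A)%E.
Proof.
move=> mA; rewrite /mixture integral_mkcond epatch_indic.
transitivity (\int[nu]_y \int[P]_x fA A (y, x))%E.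
  apply: eq_integral => y _; rewrite -ge0_integralZr//.
  - by apply/measurable_EFinP; exact: measurable_density_kernel1.
  - by move=> x _; rewrite lee_fin dk_ge0.
  - by rewrite lee_fin.
apply: etrans (@fubini_tonelli _ _ _ _ _ nu P (fA A) (measurable_fA mA) (fA_ge0 A)) _.
by apply: eq_integral => x _; apply/esym; exact: componentA.
Qed.

Lemma Rintegral_mixture P h : bounded_mfun h ->
  \int[mixture f P]_y h y = \int[P]_x \int[component x]_y h y.
Proof.
exact: (@Rintegral_family _ _ _ _ _ (fun x => mixture f \d_x)
  measurable_component P (mixture f P) (mixtureE P)).
Qed.

Lemma measurable_mixture dO (Omega : measurableType dO) (P : Omega -> probability X R) :
  (forall U, measurable U -> measurable_fun [set: Omega] (fun w => P w U)) ->
  forall A, measurable A -> measurable_fun [set: Omega] (fun w => mixture f (P w) A).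
Proof.
move=> mP A mA; rewrite (_ : (fun _ => _) = fun w => (\int[P w]_x component x A)%E).
  by apply: measurable_fun_integral_kernel => //; exact: measurable_component.
by apply/funext => w; exact: mixtureE.
Qed.

Section smooth.
Variable k : Y -> Y -> R.
Hypothesis kernel_k : is_kernel k.
Variable H : rkhs k.

Lemma density_product_integrable x1 x2 : (nu \x nu)%E.-integrable [set: Y * Y]
  (fun z => (f z.1 x1 * f z.2 x2)%:E).
Proof.
have m1 := measurable_density_kernel2 x1; have m2 := measurable_density_kernel2 x2.
apply/integrable12ltyP.
  apply/measurable_EFinP/measurable_funM.
    exact: measurableT_comp m1 measurable_fst.
  exact: measurableT_comp m2 measurable_snd.
rewrite (eq_integral (fun y => (f y x1)%:E)) ?dk_int1 ?ltry// => y _.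
under eq_integral do rewrite /= ger0_norm ?mulr_ge0 ?dk_ge0// EFinM.
rewrite ge0_integralZl//; last 3 first.
- exact/measurable_EFinP.
- by move=> ? _; rewrite lee_fin dk_ge0.
- by rewrite lee_fin dk_ge0.
by rewrite dk_int1 mule1.
Qed.

(** Fubini, justified by domination by [M] times the product density, followed by absorbing each
    density into the law of its component. *)
Lemma smooth_kernel_component x1 x2 : smooth_kernel f k x1 x2 =
  \int[component x2]_t \int[component x1]_s k s t.
Proof.
have kb := kernel_bounded_mfun kernel_k; have [mk [M kM]] := kb.
have m1 := measurable_density_kernel2 x1; have m2 := measurable_density_kernel2 x2.
pose g (z : Y * Y) := (k z.1 z.2 * f z.1 x1 * f z.2 x2)%:E.
have gi : (nu \x nu)%E.-integrable [set: Y * Y] g.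
  have fi := integrableZl measurableT M (density_product_integrable x1 x2).
  apply: (le_integrable _ _ _ fi) => //.
    apply/measurable_EFinP/measurable_funM; last first.
      exact: measurableT_comp m2 measurable_snd.
    by apply: measurable_funM => //; exact: measurableT_comp m1 measurable_fst.
  move=> z _; rewrite /g /= lee_fin -mulrA !normrM.
  rewrite ler_wpM2r ?mulr_ge0//.
  by rewrite (le_trans (kM z))// ler_norm.
have sec1 t : bounded_mfun (fun s => k s t).
  exact: (bounded_mfun_section2 (k := fun z => k z.1 z.2) kb t).
have dens x (h : Y -> R) : bounded_mfun h ->
    (\int[component x]_y (h y)%:E = \int[nu]_y ((h y)%:E * (f y x)%:E))%E.
  move=> hb; apply: (@integral_density _ _ _ (mixture f \d_x) nu).
  - by apply/measurable_EFinP; exact: measurable_density_kernel2.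
  - by move=> A _; exact: componentE.
  - exact: bounded_mfun_integrable.
have embb : bounded_mfun (fun t => \int[component x1]_s k s t).
  have := rmem_bounded_mfun kernel_k (rmem_embedding kernel_k H (mixture f \d_x1)).
  by congr bounded_mfun; apply/funext => t; exact: embeddingE.
rewrite /smooth_kernel {1}/Rintegral -(integral21_prod_meas1 gi).
rewrite [in RHS]/Rintegral dens//.
congr fine; apply: eq_integral => t _; rewrite /fubini_G.
rewrite -bounded_mfun_EFin_Rintegral// dens// -integralZr//.
apply: (le_integrable _ _ _ (integrableZl _ M
  (_ : nu.-integrable [set: Y] (fun y => (f y x1)%:E)))) => //.
- apply/measurable_EFinP/measurable_funM => //.
  by have [] := sec1 t.
- move=> s _; rewrite /= lee_fin !normrM ler_wpM2r//.
  by rewrite (le_trans (kM (s, t)))// ler_norm.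
- apply/integrableP; split; first exact/measurable_EFinP.
  under eq_integral do rewrite /= ger0_norm ?dk_ge0//.
  by rewrite dk_int1 ltry.
Qed.

Lemma smooth_kernel_rdot x1 x2 : smooth_kernel f k x1 x2 =
  rdot H (embedding k (mixture f \d_x1)) (embedding k (mixture f \d_x2)).
Proof. by rewrite smooth_kernel_component rdot_embedding2. Qed.

Lemma bounded_mfun_smooth_kernel t :
  bounded_mfun (fun x => smooth_kernel f k x t).
Proof.
rewrite (_ : (fun _ => _) =
    (fun x => \int[component x]_y embedding k (mixture f \d_t) y)).
  apply: (@bounded_mfun_family_Rintegral _ _ _ _ _ (fun x => mixture f \d_x)).
    exact: measurable_component.
  exact/(rmem_bounded_mfun kernel_k)/(rmem_embedding kernel_k H).
apply/funext => x; have Hemb p := rmem_embedding kernel_k H p.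
by rewrite smooth_kernel_rdot rdotC// (rdot_embedding kernel_k).
Qed.

(** Both sides are the inner product of the embeddings of [mixture f P] and of the component at [t].
    Hence the embedding of [P] for the smoothed kernel depends only on that of [mixture f P] for
    [k]. *)
Lemma Rintegral_smooth_kernel P t : \int[P]_x smooth_kernel f k x t =
  \int[component t]_y embedding k (mixture f P) y.
Proof.
have Hemb p := rmem_embedding kernel_k H p.
rewrite -(rdot_embedding kernel_k (H := H))// rdotC// (rdot_embedding kernel_k)//.
rewrite Rintegral_mixture.
  by apply: eq_Rintegral => x _;
    rewrite smooth_kernel_rdot rdotC// (rdot_embedding kernel_k).
exact: (rmem_bounded_mfun kernel_k).
Qed.

End smooth.
End mixture_theory.

(** * From equality of embedded mixtures to equality of mixing measures *)

Section universal_smooth_kernel.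
Context (R : realType) (X : ptopologicalType) dY (Y : measurableType dY).
Variables (nu : {sigma_finite_measure set Y -> \bar R}).
Variables (f : density_kernel (borel X) nu) (k : Y -> Y -> R).
Hypothesis kernel_k : is_kernel k.
Variable H : rkhs k.
Hypothesis universal_kf : c0_universal (smooth_kernel f k).

(** The smoothed embeddings of [p1 + a q2] and [q1 + a p2] at [t] are integrals of the two sides of
    the assumption against the component at [t]; injectivity concludes. *)
Lemma universal_measure_combination (p1 p2 q1 q2 : probability (borel X) R) a :
  0 <= a ->
  embedding k (mixture f p1) + a *: embedding k (mixture f q2) =
  embedding k (mixture f q1) + a *: embedding k (mixture f p2) ->
  forall A : set (borel X), measurable A ->
    (p1 A + a%:E * q2 A = q1 A + a%:E * p2 A)%E.
Proof.
move=> a0 E A mA; have [_ inj] := universal_kf.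
have eb p := rmem_bounded_mfun kernel_k (rmem_embedding kernel_k H p).
have lin (p q : probability (borel X) R) t :
    mean_embedding (smooth_kernel f k)
      (charge_of_finite_measure (measure_combination p q (NngNum a0))) t =
    \int[mixture f \d_t]_y
      (embedding k (mixture f p) + a *: embedding k (mixture f q)) y.
  rewrite /mean_embedding charge_integral_measure.
  rewrite Rintegral_measure_combination; last first.
    exact: (bounded_mfun_smooth_kernel f kernel_k H).
  rewrite (Rintegral_smooth_kernel f kernel_k H p t).
  rewrite (Rintegral_smooth_kernel f kernel_k H q t).
  by rewrite RintegralDZ.
have emb_eq : mean_embedding (smooth_kernel f k)
      (charge_of_finite_measure (measure_combination p1 q2 (NngNum a0))) =
    mean_embedding (smooth_kernel f k)
      (charge_of_finite_measure (measure_combination q1 p2 (NngNum a0))).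
  by apply/funext => t; rewrite lin E -lin.
have := inj _ _ emb_eq A mA.
rewrite -[LHS]/(measure_combination p1 q2 (NngNum a0) A).
rewrite -[RHS]/(measure_combination q1 p2 (NngNum a0) A).
by rewrite [LHS]measure_combinationE [RHS]measure_combinationE.
Qed.

End universal_smooth_kernel.

(** * Countable sets, atoms and discrete measures in a Polish space *)

Section polish_borel.
Context (R : realType) (X : ptopologicalType).
Hypothesis polishX : polish R X.

Lemma polish_open_setC1 (x : X) : open (~` [set x]).
Proof.
have [_ [d [d_ge0 d_eq0 d_sym d_tri d_nbhs] _]] := polishX.
rewrite openE => y /= yx; rewrite /interior; apply/(d_nbhs y).
(* The open ball of this radius around [y] misses [x]. *)
exists (d y x).
  by rewrite lt_neqAle d_ge0 andbT eq_sym; apply/eqP => /d_eq0.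
by move=> z /= yz zx; move: yz; rewrite zx ltxx.
Qed.

Lemma polish_measurable_set1 (x : borel X) : measurable [set x].
Proof.
rewrite -[[set x]]setCK; apply: measurableC.
by apply: sub_sigma_algebra; exact: polish_open_setC1.
Qed.

Lemma polish_measurable_countable (A : set (borel X)) : countable A -> measurable A.
Proof. by apply: countable_measurable => x; exact: polish_measurable_set1. Qed.

(** An injection into the naturals cuts [A] into countably many pieces of at most one point each,
    all negligible. *)
Lemma atomless_countable (q : probability (borel X) R) (A : set (borel X)) :
  atomless q -> countable A -> q A = 0%E.
Proof.
move=> q0 cA; have mA := polish_measurable_countable cA.
have /countable_injP[g injg] := cA.
apply/negligibleP => //.
rewrite (_ : A = \bigcup_n (A `&` g @^-1` [set n])); last first.
  by apply/seteqP; split=> [x Ax|x [n _ []]//]; exists (g x).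
apply: negligible_bigcup => n.
have [->|/set0P[x [Ax /= gx]]] := eqVneq (A `&` g @^-1` [set n]) set0.
  exact: negligible_set0.
apply: (@negligibleS _ _ _ _ [set x]).
  by move=> y [Ay /= gy]; apply: injg; rewrite ?inE// gx.
by apply/negligibleP; [exact: polish_measurable_set1|exact: q0].
Qed.

(* Both sides are tested on a countable set carrying the discrete measures,
   which the atomless ones do not charge. *)
Lemma discrete_atomless_proportional (p1 p2 q1 q2 : probability (borel X) R) a :
  discrete_measure p1 -> discrete_measure p2 -> atomless q1 -> atomless q2 ->
  (forall A : set (borel X), measurable A ->
    (p1 A + a%:E * q2 A = q1 A + a%:E * p2 A)%E) ->
  forall A : set (borel X), measurable A -> (p1 A = a%:E * p2 A)%E.
Proof.
move=> [A1 cA1 pA1] [A2 cA2 pA2] q10 q20 E A mA.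
pose D := A1 `|` A2.
have cD : countable D.
  by rewrite /D -bigcup2E; apply: bigcup_countable => // -[|[|n]].
have mA1 := polish_measurable_countable cA1; have mA2 := polish_measurable_countable cA2.
have mD := polish_measurable_countable cD.
have restrict (p : probability (borel X) R) (C : set (borel X)) : measurable C ->
    p (~` C) = 0%E -> C `<=` D -> p A = p (A `&` D).
  move=> mC pC CD; rewrite (measureDI p mA mD).
  rewrite (subset_measure0 _ _ _ pC) ?add0e//; first exact: measurableD.
    exact: measurableC.
  by move=> x [_ nDx] Cx; exact/nDx/CD.
have nocharge (q : probability (borel X) R) : atomless q -> q (A `&` D) = 0%E.
  move=> q0; apply: (subset_measure0 _ _ (@subIsetr _ A D)) => //.
    exact: measurableI.
  exact: atomless_countable.
rewrite (restrict p1 A1)//; last exact: subsetUl.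
rewrite (restrict p2 A2)//; last exact: subsetUr.
have := E (A `&` D) (measurableI _ _ mA mD).
by rewrite (nocharge q1)// (nocharge q2)// mule0 adde0 add0e.
Qed.

End polish_borel.

(** * Proportionality of random mixing measures *)

Section random_mixture.
Context (R : realType) (X : ptopologicalType) dY (Y : measurableType dY).
Hypothesis polishX : polish R X.
Variables (nu : {sigma_finite_measure set Y -> \bar R}).
Variables (f : density_kernel (borel X) nu) (k : Y -> Y -> R).
Hypothesis kernel_k : is_kernel k.
Variable H : rkhs k.
Hypothesis universal_kf : c0_universal (smooth_kernel f k).
Context dO (Omega : measurableType dO) (Pr : probability Omega R).
Local Notation measurable_family P := (forall U, measurable U ->
  measurable_fun [set: Omega] (fun w => P w U)).

(** Averaging commutes with mixing: both measures integrate the components against the mean of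
    [P]. *)
Lemma barycenter_mixture (P : Omega -> probability (borel X) R)
    (mP : measurable_family P) (mQ : measurable_family (fun w => mixture f (P w))) :
  embedding k (barycenter Pr mQ) =
  embedding k (mixture f (barycenter Pr mP)).
Proof.
apply: eq_embedding => A mA.
apply: etrans (barycenterE Pr mQ mA) _.
apply: etrans _ (esym (mixtureE f (barycenter Pr mP) mA)).
rewrite (ge0_integral_family mP (barycenterE Pr mP) (measurable_component f mA))//.
by apply: eq_integral => w _; exact: mixtureE.
Qed.

Variables P1 P2 : Omega -> probability (borel X) R.
Hypotheses (mP1 : measurable_family P1) (mP2 : measurable_family P2).
Hypothesis discrete1 : {ae Pr, forall w, discrete_measure (P1 w)}.
Hypothesis discrete2 : {ae Pr, forall w, discrete_measure (P2 w)}.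
Hypothesis atomless1 : atomless (mean_measure Pr P1).
Hypothesis atomless2 : atomless (mean_measure Pr P2).

Lemma centered_proportional (m1 m2 : Y -> R) a : 0 <= a ->
  m1 = embedding k (mixture f (barycenter Pr mP1)) ->
  m2 = embedding k (mixture f (barycenter Pr mP2)) ->
  {ae Pr, forall w, embedding k (mixture f (P1 w)) - m1 =
    a *: (embedding k (mixture f (P2 w)) - m2)} ->
  {ae Pr, forall w, forall A : set (borel X), measurable A ->
    (P1 w A = a%:E * P2 w A)%E}.
Proof.
move=> a0 -> ->; apply: (filterS3 _ _ discrete1 discrete2) => w d1 d2 E.
have al (P : Omega -> probability (borel X) R) (mP : measurable_family P) :
    atomless (mean_measure Pr P) -> atomless (barycenter Pr mP).
  move=> P0 x; have mx := polish_measurable_set1 polishX x.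
  exact: etrans (barycenterE Pr mP mx) (P0 x).
apply: (discrete_atomless_proportional polishX d1 d2
  (al _ mP1 atomless1) (al _ mP2 atomless2)).
apply: (universal_measure_combination kernel_k H universal_kf a0).
(* Moving the means across turns the centered identity into one with nonnegative coefficients
   only. *)
move/eqP: E; rewrite scalerBr subr_eq => /eqP ->.
by rewrite addrAC subrK addrC.
Qed.

End random_mixture.

(** * Unit correlation and almost sure equality of mixtures *)

Lemma ratio_sqrt_eq1 (R : rcfType) (v v1 v2 c : R) :
  0 <= v -> v != 0 -> v1 = v -> v2 = v -> c = v ->
  c / (Num.sqrt v1 * Num.sqrt v2) = 1.
Proof. by move=> v0 vn0 -> -> ->; rewrite -expr2 sqr_sqrtr// divff. Qed.

Lemma ae_not_False (R : realType) d (T : measurableType d) (Pr : probability T R) :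
  ~ {ae Pr, forall w : T, False}.
Proof.
move=> [N [mN N0 sub]]; have := probability_setT Pr.
rewrite (_ : [set: T] = N); last first.
  by apply/seteqP; split => // x _; apply: sub.
by rewrite N0 => /esym/eqP; rewrite onee_eq0.
Qed.

Theorem corollary17 (R : realType)
    (X Y : ptopologicalType)
    (polishX : polish R X) (lcX : locally_compact [set: X])
    (polishY : polish R Y) (lcY : locally_compact [set: Y])
    (nu : {sigma_finite_measure set (borel Y) -> \bar R})
    (dO : measure_display) (Omega : measurableType dO)
    (Pr : probability Omega R)
    (P1 P2 : {RV Pr >-> pprobability (borel X) R})
    (discrete1 : {ae Pr, forall w, discrete_measure (P1 w)})
    (discrete2 : {ae Pr, forall w, discrete_measure (P2 w)})
    (atomless1 : atomless (mean_measure Pr P1))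
    (atomless2 : atomless (mean_measure Pr P2))
    (f : density_kernel (borel X) nu)
    (k : borel Y -> borel Y -> R) (kernel_k : is_kernel k)
    (H : rkhs k)
    (universal_kf : c0_universal (smooth_kernel f k)) :
  kcorr Pr H (fun w => mixture f (P1 w)) (fun w => mixture f (P2 w)) = 1 <->
  {ae Pr, forall w, {ae nu, forall y,
    mixture_density f (P1 w) y = mixture_density f (P2 w) y}}.
Proof.
(* A measurable map into the space of probabilities is a probability kernel, so its evaluations are
   measurable. *)
have mRV (P : {RV Pr >-> pprobability (borel X) R}) (U : set (borel X)) :
    measurable U -> measurable_fun [set: Omega] (fun w => P w U).
  exact: (measurable_kernel (kprobability (@measurable_funPT _ _ _ _ P))).
have mP1 := mRV P1; have mP2 := mRV P2.
have mQ1 := measurable_mixture f mP1; have mQ2 := measurable_mixture f mP2.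
pose m1 := embedding k (barycenter Pr mQ1); pose m2 := embedding k (barycenter Pr mQ2).
have m1E := barycenter_mixture k Pr mP1 mQ1.
have m2E := barycenter_mixture k Pr mP2 mQ2.
pose V1 w := embedding k (mixture f (P1 w)) - m1.
pose V2 w := embedding k (mixture f (P2 w)) - m2.
have HV1 w : rmem H (V1 w) by apply: rmemB; exact: rmem_embedding.
have HV2 w : rmem H (V2 w) by apply: rmemB; exact: rmem_embedding.
have b11 : bounded_mfun (fun w => rdot H (V1 w) (V1 w)).
  exact: (bounded_mfun_centered_rdot kernel_k H _ _ mQ1 mQ1).
have b12 : bounded_mfun (fun w => rdot H (V1 w) (V2 w)).
  exact: (bounded_mfun_centered_rdot kernel_k H _ _ mQ1 mQ2).
have b22 : bounded_mfun (fun w => rdot H (V2 w) (V2 w)).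
  exact: (bounded_mfun_centered_rdot kernel_k H _ _ mQ2 mQ2).
have c11 := kcovE kernel_k H Pr mQ1 mQ1; have c22 := kcovE kernel_k H Pr mQ2 mQ2.
have c12 := kcovE kernel_k H Pr mQ1 mQ2.
split.
  rewrite /kcorr => corr.
  have [a a0 V12] := correlation1_proportional HV1 HV2 b11 b12 b22 c11 c22 c12 corr.
  have := centered_proportional polishX kernel_k H universal_kf discrete1 discrete2
    atomless1 atomless2 a0 m1E m2E V12.
  apply: filterS => w E.
  (* Compare total masses. *)
  have a1 : a%:E = 1%E.
    have := E setT measurableT.
    by rewrite !probability_setT mule1 => /esym.
  (* The mixing measures now coincide, so the densities agree at every [y]. *)
  apply: aeW => y; apply: eq_measure_integral => A mA _.
  by have := E A mA; rewrite a1 mul1e.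
move=> fE.
have V1_neq0 : \int[Pr]_w rdot H (V1 w) (V1 w) != 0.
  apply/eqP => V0; apply: (@ae_not_False _ _ _ Pr).
  (* Zero variance, written as proportionality of [P1] to itself with factor 0, would make [P1 w]
     the zero measure almost surely. *)
  have V10 : {ae Pr, forall w, V1 w = 0 *: V1 w}.
    by apply: filterS (rkhs_ae_eq0 HV1 b11 V0) => w ->; rewrite scaler0.
  have := centered_proportional polishX kernel_k H universal_kf discrete1 discrete1
    atomless1 atomless1 (lexx 0) m1E m1E V10.
  apply: filterS => w /(_ setT measurableT).
  by rewrite mul0e probability_setT => /eqP; rewrite onee_eq0.
have mixE : {ae Pr, forall w, forall A, measurable A ->
    mixture f (P1 w) A = mixture f (P2 w) A}.
  apply: filterS fE => w fw A mA; apply: ae_eq_integral => //.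
  - exact: measurable_funTS (measurable_mixture_density _ _).
  - exact: measurable_funTS (measurable_mixture_density _ _).
  - by apply: filterS fw => y.
(* Almost surely equal random mixtures have equal barycenters, so the centered embeddings agree too
   and covariance and variances coincide. *)
have mE : m1 = m2.
  apply: eq_embedding => A mA.
  apply: etrans (barycenterE Pr mQ1 mA) _; apply: etrans _ (esym (barycenterE Pr mQ2 mA)).
  apply: ae_eq_integral => //; [exact: mQ1 mA|exact: mQ2 mA|].
  by apply: filterS mixE => w /(_ A mA).
have VE : {ae Pr, forall w, V1 w = V2 w}.
  by apply: filterS mixE => w /eq_embedding E; rewrite /V1 /V2 mE (E k).
have e22 : \int[Pr]_w rdot H (V2 w) (V2 w) = \int[Pr]_w rdot H (V1 w) (V1 w).
  by apply: ae_eq_Rintegral b22 b11 _; apply: filterS VE => w ->.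
have e12 : \int[Pr]_w rdot H (V1 w) (V2 w) = \int[Pr]_w rdot H (V1 w) (V1 w).
  by apply: ae_eq_Rintegral b12 b11 _; apply: filterS VE => w ->.
apply: ratio_sqrt_eq1 V1_neq0 c11 (etrans c22 e22) (etrans c12 e12).
by apply: Rintegral_ge0 => w _; exact: rdot_ge0 (HV1 w).
Qed.
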